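(* Let $H$ be a complex Hilbert space. For all $A,B\in B(H)_{++}$, $$|\operatorname{OLC}(A)-\operatorname{OLC}(B)|\le\delta_T([A],[B]).$$
   Context: $B(H)$ is the algebra of bounded operators on $H$ with operator norm $\|\cdot\|$; $B(H)_{++}$ is the set of positive invertible operators. For invertible $A$, $\kappa(A):=\|A\|\,\|A^{-1}\|$ and $\operatorname{OLC}(A):=\tfrac12\ln\kappa(A)$. The Thompson metric on $B(H)_{++}$ is $d_T(A,B):=\|\log(A^{-1/2}BA^{-1/2})\|$; on rays $[A]=\{\lambda A:\lambda>0\}$ the projective Thompson metric is $\delta_T([A],[B]):=\inf_{\lambda>0}d_T(A,\lambda B)$. *)

(* Defs.v *)
From mathcomp Require Export all_boot all_order all_algebra sesquilinear.
From mathcomp Require Export complex.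
From mathcomp Require Export all_classical all_reals all_analysis.

Set Implicit Arguments.
Unset Strict Implicit.
Unset Printing Implicit Defensive.

Export Order.TTheory GRing.Theory Num.Theory numFieldNormedType.Exports.

Global Open Scope complex_scope.
Global Open Scope classical_set_scope.
Global Open Scope ring_scope.

(* The norm of a normed module over R[i] takes its values in R[i] (on the
   nonnegative real axis); norms of vectors and operators are brought back to R
   with complex.Re. The order of R[i] is the partial one: 0 <= z says that z is
   real and nonnegative. *)

(* A complete normed module H over R[i] is a Hilbert space when its norm comes
   from an inner product dot (linear in the first argument, conjugate-linear in
   the second). *)
Definition hilbert_norm (R : realType) (H : completeNormedModType R[i])
    (dot : {dot H for Num.conj}) : Prop :=
  forall x : H, dot x x = `|x| ^+ 2.

Section Operators.
Context {R : realType} {H : completeNormedModType R[i]}.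
Implicit Types (A B T : H -> H) (f : R -> R).

(* B(H) is the set of maps H -> H satisfying this predicate; sums and scalar
   multiples are the pointwise ones, the product is \o. *)
Definition bounded_operator A : Prop :=
  linear A /\ exists M : R, forall x : H, `|A x| <= M%:C * `|x|.

(* The supremum is meaningful for bounded A only (sup is 0 on an unbounded set). *)
Definition opnorm A : R :=
  sup [set complex.Re `|A x| | x in [set x : H | `|x| <= 1]].

Definition is_inverse A B : Prop :=
  [/\ bounded_operator B, A \o B = id & B \o A = id].

Definition invertible A : Prop := exists B, is_inverse A B.

(* Equal to 0 when A is not invertible. *)
Definition op_inv A : H -> H := xget 0 [set B | is_inverse A B].

Definition positive_operator (dot : {dot H for Num.conj}) A : Prop :=
  forall x : H, 0 <= dot (A x) x.

(* The set B(H)_{++}. *)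
Definition Bpp (dot : {dot H for Num.conj}) : set (H -> H) :=
  [set A | [/\ bounded_operator A, positive_operator dot A & invertible A]].

Definition spectrum A : set R[i] :=
  [set z | ~ invertible (A - (fun x => z *: x))].

(* The whole spectrum when A is self-adjoint. *)
Definition real_spectrum A : set R := [set t | spectrum A t%:C].

Definition poly_op (p : {poly R}) A : H -> H :=
  \sum_(i < size p) (p`_i)%:C *: (iter i A : H -> H).

(* Continuous functional calculus of a self-adjoint A for a real function f
   continuous on the spectrum: f(A) is the operator-norm limit of p_n(A), for
   polynomials p_n converging to f uniformly on the spectrum of A. *)
Definition is_cfc f A T : Prop :=
  bounded_operator T /\
  exists p : nat -> {poly R},
    {uniform real_spectrum A, (fun n => horner (p n)) @ \oo --> f} /\
    opnorm (poly_op (p n) A - T) @[n --> \oo] --> (0 : R).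

Definition cfc f A : H -> H := xget 0 [set T | is_cfc f A T].

Definition op_log A : H -> H := cfc (@ln R) A.

Definition op_invsqrt A : H -> H := cfc (fun t : R => t `^ (- 2^-1)) A.

Definition condition_number A : R := opnorm A * opnorm (op_inv A).

Definition OLC A : R := 2^-1 * ln (condition_number A).

Definition thompson A B : R :=
  opnorm (op_log (op_invsqrt A \o B \o op_invsqrt A)).

(* delta_T([A], [B]), as a function of representatives of the two rays. *)
Definition proj_thompson A B : R :=
  inf [set thompson A (l%:C *: B) | l in [set l : R | 0 < l]].

End Operators.

(* Main.v *)
(**
Let mu = thompson A (l B) and C = A^(-1/2) (l B) A^(-1/2). Both ends of the
numerical range of C belong to its spectrum, and |ln t| <= ||log C|| = mu for t
in the spectrum, so exp(-mu) <= C <= exp(mu); applying this to A^(1/2) x gives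
exp(-mu) A <= l B <= exp(mu) A as quadratic forms. Hence ||B|| and ||B^-1|| are
at most exp(mu)/l and exp(mu) l times ||A|| and ||A^-1||, i.e.
kappa(B) <= exp(2 mu) kappa(A), and symmetrically.

That the functional calculus exists and does not depend on the approximating
polynomials comes from ||p(A)|| = max |p| over the spectrum, for A self-adjoint
and p real: with s = ||p(A)||, the operator p(A)^2 - s^2 is not bounded below,
hence neither is A - z for some complex root z of p^2 - s^2, and this z must be
real since ||(A - z) x|| >= |Im z| ||x||.
*)
Require Import Defs.
From mathcomp Require Import ring lra.

Set Implicit Arguments.
Unset Strict Implicit.
Unset Printing Implicit Defensive.

(** * Vector norms with real values *)

Section NormReal.
Context {R : realType} {H : completeNormedModType R[i]}.
Implicit Types (x y : H) (A B T : H -> H).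

Definition nrm x : R := complex.Re `|x|.

Lemma nrmE x : `|x| = (nrm x)%:C.
Proof. by rewrite /nrm RRe_real// ger0_real. Qed.

Lemma nrm_ge0 x : 0 <= nrm x.
Proof. by rewrite -ler0c -nrmE. Qed.

Lemma nrm0 : nrm 0 = 0.
Proof. by rewrite /nrm normr0. Qed.

Lemma nrm_eq0 x : (nrm x == 0) = (x == 0).
Proof.
rewrite -[RHS]normr_eq0 nrmE.
by apply/eqP/eqP => [->|/(congr1 (@complex.Re R))].
Qed.

Lemma nrmN x : nrm (- x) = nrm x.
Proof. by rewrite /nrm normrN. Qed.

Lemma nrmB x y : nrm (x - y) = nrm (y - x).
Proof. by rewrite -nrmN opprB. Qed.

Lemma nrmD x y : nrm (x + y) <= nrm x + nrm y.
Proof. by rewrite -lecR rmorphD/= -!nrmE ler_normD. Qed.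

Lemma nrm_triangle z x y : nrm (x - y) <= nrm (x - z) + nrm (z - y).
Proof. by rewrite -{1}(subrK z x) -addrA nrmD. Qed.

Lemma nrmZ (a : R[i]) x : nrm (a *: x) = complex.Re `|a| * nrm x.
Proof.
by rewrite /nrm normrZ nrmE normc_def/= mul0r subr0.
Qed.

Lemma nrmZr (a : R) x : nrm (a%:C *: x) = `|a| * nrm x.
Proof. by rewrite nrmZ normc_def/= expr0n addr0 sqrtr_sqr. Qed.

Lemma nrm_complete (u : nat -> H) :
  (forall e : R, 0 < e -> exists N, forall m n, (N <= m)%N -> (N <= n)%N ->
     nrm (u m - u n) < e) ->
  exists l, forall e : R, 0 < e -> exists N, forall n, (N <= n)%N ->
     nrm (u n - l) < e.
Proof.
move=> cu.
have cvgu : cvgn u.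
  (* The radius [e] lies in [R[i]]: its positivity splits into a vanishing imaginary part and a
     positive real part, to which the hypothesis applies. *)
  apply: cauchy_cvg; apply: cauchy_exP => e; rewrite ltcE/= => /andP[eI e0].
  have [N NP] := cu _ e0; exists (u N), N => // n /= Nn.
  by rewrite -ball_normE/= nrmE ltcE/= eI NP//=.
exists (limn u) => e e0.
have /cvgrPdist_lt/(_ (e%:C)) : u @ \oo --> limn u by [].
rewrite ltcR => /(_ e0)[N _ NP]; exists N => n Nn.
by have := NP n Nn; rewrite /= nrmE ltcR nrmB.
Qed.

End NormReal.

(** * Bounded operators *)

Section LinearMaps.
Context {K : nzRingType} {V : lmodType K}.
Implicit Types (A : V -> V).

Lemma lin_add A : linear A -> forall x y, A (x + y) = A x + A y.
Proof. by move=> lA x y; have := lA 1 x y; rewrite !scale1r. Qed.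

Lemma lin_0 A : linear A -> A 0 = 0.
Proof. by move=> lA; apply: (addrI (A 0)); rewrite -lin_add// !addr0. Qed.

Lemma lin_scale A : linear A -> forall a x, A (a *: x) = a *: A x.
Proof. by move=> lA a x; have := lA a x 0; rewrite !addr0 lin_0// addr0. Qed.

Lemma lin_sub A : linear A -> forall x y, A (x - y) = A x - A y.
Proof.
by move=> lA x y; rewrite -scaleN1r lin_add// lin_scale// scaleN1r.
Qed.

Lemma lin_sum A : linear A -> forall I (r : seq I) (P : pred I) (F : I -> V),
  A (\sum_(i <- r | P i) F i) = \sum_(i <- r | P i) A (F i).
Proof. by move=> lA I r P F; apply: big_morph; [exact: lin_add|exact: lin_0]. Qed.

End LinearMaps.

Section BoundedOperators.
Context {R : realType} {H : completeNormedModType R[i]}.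
Implicit Types (x y : H) (A B T : H -> H).

Lemma bounded_operatorP A : bounded_operator A <->
  linear A /\ exists M : R, forall x, nrm (A x) <= M * nrm x.
Proof.
have eqM M : (forall x, `|A x| <= M%:C * `|x|) <->
    forall x, nrm (A x) <= M * nrm x.
  by split=> h x; have := h x; rewrite !nrmE -rmorphM/= lecR.
by split=> -[lA [M /eqM hM]]; split => //; exists M.
Qed.

Lemma opnorm_set_nonempty A :
  [set complex.Re `|A x| | x in [set x : H | `|x| <= 1]] !=set0.
Proof. by exists (nrm (A 0)), 0 => //=; rewrite normr0 ler01. Qed.

Lemma opnorm_le A M : 0 <= M -> (forall x, nrm (A x) <= M * nrm x) ->
  opnorm A <= M.
Proof.
move=> M0 hM; apply: ge_sup; first exact: opnorm_set_nonempty.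
move=> _ [x /= x1 <-]; rewrite (le_trans (hM x))// -[leRHS]mulr1.
by apply: ler_wpM2l => //; rewrite -lecR -nrmE.
Qed.

Lemma le_opnorm A : bounded_operator A ->
  forall x, nrm (A x) <= opnorm A * nrm x.
Proof.
move=> /bounded_operatorP[lA [M hM]] x.
have [->|x0] := eqVneq x 0; first by rewrite lin_0// nrm0 mulr0.
have nx0 : 0 < nrm x by rewrite lt0r nrm_eq0 x0 nrm_ge0.
have M0 : 0 <= M.
  by rewrite -(pmulr_lge0 _ nx0) (le_trans _ (hM x))// nrm_ge0.
rewrite -ler_pdivrMr// mulrC.
have -> : (nrm x)^-1 * nrm (A x) = nrm (A ((nrm x)^-1%:C *: x)).
  by rewrite lin_scale// nrmZr ger0_norm// invr_ge0 nrm_ge0.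
apply: ub_le_sup.
  exists M => _ [y /= y1 <-]; rewrite (le_trans (hM y))// -[leRHS]mulr1.
  by apply: ler_wpM2l => //; rewrite -lecR -nrmE.
exists ((nrm x)^-1%:C *: x) => //=.
rewrite nrmE nrmZr ger0_norm ?invr_ge0 ?nrm_ge0//.
by rewrite mulVf ?gt_eqF.
Qed.


Lemma bounded_id : bounded_operator (id : H -> H).
Proof. by apply/bounded_operatorP; split=> //; exists 1 => x; rewrite mul1r. Qed.

Lemma bounded_zero : bounded_operator (0 : H -> H).
Proof.
apply/bounded_operatorP; split; first by move=> a x y /=; rewrite scaler0 addr0.
by exists 0 => x; rewrite nrm0 mul0r.
Qed.

Lemma bounded_ge0 A : bounded_operator A ->
  exists2 M : R, 0 <= M & forall x, nrm (A x) <= M * nrm x.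
Proof.
move=> /bounded_operatorP[lA [M hM]]; exists `|M| => // x.
by rewrite (le_trans (hM x))// ler_wpM2r ?nrm_ge0 ?ler_norm.
Qed.

Lemma bounded_comp A B : bounded_operator A -> bounded_operator B ->
  bounded_operator (A \o B).
Proof.
move=> bA bB; have [M M0 hM] := bounded_ge0 bA; have [N N0 hN] := bounded_ge0 bB.
apply/bounded_operatorP; split.
  by move=> a x y /=; rewrite bB.1 bA.1.
exists (M * N) => x /=; rewrite (le_trans (hM _))// -mulrA.
by rewrite ler_wpM2l.
Qed.

Lemma bounded_add A B : bounded_operator A -> bounded_operator B ->
  bounded_operator (A + B).
Proof.
move=> bA bB; have [M M0 hM] := bounded_ge0 bA; have [N N0 hN] := bounded_ge0 bB.
apply/bounded_operatorP; split.
  by move=> a x y; rewrite !fctE bB.1 bA.1 scalerDr addrACA.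
exists (M + N) => x; rewrite !fctE mulrDl.
by rewrite (le_trans (nrmD _ _))// lerD.
Qed.

Lemma bounded_scale (c : R[i]) A : bounded_operator A -> bounded_operator (c *: A).
Proof.
move=> bA; have [M M0 hM] := bounded_ge0 bA.
apply/bounded_operatorP; split.
  by move=> a x y; rewrite !fctE bA.1 scalerDr !scalerA mulrC.
exists (complex.Re `|c| * M) => x; rewrite !fctE nrmZ -mulrA.
by rewrite ler_wpM2l// normc_def/= sqrtr_ge0.
Qed.

Lemma bounded_opp A : bounded_operator A -> bounded_operator (- A).
Proof. by move=> bA; rewrite -scaleN1r; exact: bounded_scale. Qed.

Lemma bounded_sub A B : bounded_operator A -> bounded_operator B ->
  bounded_operator (A - B).
Proof. by move=> bA bB; apply: bounded_add => //; exact: bounded_opp. Qed.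

Lemma bounded_iter n A : bounded_operator A -> bounded_operator (iter n A).
Proof.
move=> bA; elim: n => [|n IHn]; first exact: bounded_id.
exact: (bounded_comp bA IHn).
Qed.

Lemma bounded_sum I (r : seq I) (P : pred I) (F : I -> H -> H) :
  (forall i, bounded_operator (F i)) ->
  bounded_operator (\sum_(i <- r | P i) F i).
Proof.
move=> bF; apply: big_ind => //; first exact: bounded_zero.
exact: bounded_add.
Qed.

Lemma opnorm_ge0 A : bounded_operator A -> 0 <= opnorm A.
Proof.
move=> bA; have [M M0 hM] := bounded_ge0 bA.
apply: ub_le_sup; last first.
  by exists 0; rewrite /= ?normr0 ?ler01// (lin_0 bA.1) normr0.
exists M => _ [y /= y1 <-]; rewrite (le_trans (hM y))// -[leRHS]mulr1.
by apply: ler_wpM2l => //; rewrite -lecR -nrmE.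
Qed.

Lemma invertible_comp A B : invertible A -> invertible B -> invertible (A \o B).
Proof.
move=> [A' [bA' AA' A'A]] [B' [bB' BB' B'B]]; exists (B' \o A'); split.
- exact: bounded_comp.
- apply/funext => x; have /= -> := congr1 (@^~ (A' x)) BB'.
  by have /= -> := congr1 (@^~ x) AA'.
- apply/funext => x; have /= -> := congr1 (@^~ (B x)) A'A.
  by have /= -> := congr1 (@^~ x) B'B.
Qed.

Lemma invertible_scale (c : R[i]) A : c != 0 -> linear A ->
  invertible A -> invertible (c *: A).
Proof.
move=> c0 lA [A' [bA' AA' A'A]]; exists (c^-1 *: A'); split.
- exact: bounded_scale.
- apply/funext => x; rewrite /= !fctE lin_scale// scalerA divff// scale1r.
  by have /= -> := congr1 (@^~ x) AA'.
- apply/funext => x; rewrite /= !fctE lin_scale//; last by case: bA'.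
  rewrite scalerA mulVf// scale1r.
  by have /= -> := congr1 (@^~ x) A'A.
Qed.

(** If [J] inverts the product, [B \o J] is a right inverse of [A], and commutation makes it a left
    inverse too. This is how a singular [A - t] forces every polynomial multiple of it to be
    singular. *)
Lemma invertible_factor A B : bounded_operator A -> bounded_operator B ->
  A \o B = B \o A -> invertible (A \o B) -> invertible A.
Proof.
move=> bA bB AB [J [bJ ABJ JAB]].
have ABJx x : A (B (J x)) = x by have := congr1 (@^~ x) ABJ.
have JABx x : J (A (B x)) = x by have := congr1 (@^~ x) JAB.
have ABx x : A (B x) = B (A x) by have := congr1 (@^~ x) AB.
exists (B \o J); split; first exact: bounded_comp.
  by apply/funext => x /=; rewrite ABJx.
apply/funext => x /=.
by rewrite -[LHS]JABx ABx ABJx -ABx JABx.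
Qed.

(** The lower bound gives injectivity, hence linearity of the set-theoretic inverse, and bounds that
    inverse by [c^-1]. *)
Lemma bijective_invertible A (c : R) : linear A -> 0 < c ->
  (forall x, c * nrm x <= nrm (A x)) -> (forall y, exists x, A x = y) ->
  invertible A.
Proof.
move=> lA c0 cA surjA; have [B AB] := choice surjA.
have injA x y : A x = A y -> x = y.
  move=> /eqP; rewrite -subr_eq0 -lin_sub// => /eqP A0.
  apply/eqP; rewrite -subr_eq0 -nrm_eq0; apply/eqP/le_anti.
  rewrite nrm_ge0 andbT -(pmulr_rle0 _ c0) (le_trans (cA _))//.
  by rewrite A0 nrm0.
exists B; split; last 2 first.
- by apply/funext => x /=.
- by apply/funext => x; apply: injA; rewrite /= AB.
apply/bounded_operatorP; split.
  by move=> a x y; apply: injA; rewrite lA !AB.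
exists c^-1 => x; rewrite -(ler_pM2l c0) mulrA divff ?gt_eqF// mul1r.
by rewrite (le_trans (cA _))// AB.
Qed.

Lemma op_invP A : invertible A -> is_inverse A (op_inv A).
Proof. exact: xgetPex. Qed.

End BoundedOperators.

(** * Inner product and Lax-Milgram *)

Lemma geometric_lt (R : realType) (C k e : R) : 0 <= k < 1 -> 0 < e ->
  exists N, C * k ^+ N < e.
Proof.
move=> /andP[k0 k1] e0.
have k1' : `|k| < 1 by rewrite ger0_norm.
have /cvgrPdist_lt/(_ e e0)[N _ NP] := cvg_geometric C k1'.
exists N; have /= := NP _ (leqnn N).
by rewrite sub0r normrN; apply: le_lt_trans; exact: ler_norm.
Qed.

Section Contraction.
Context {R : realType} {H : completeNormedModType R[i]}.

(** Picard iteration from 0: the iterates stay in a fixed ball, so [u (n + j)] and [u n] differ by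
    at most [C * k ^+ n]. *)
Lemma contraction_affine_fixpoint (K : H -> H) (k : R) (y : H) :
  linear K -> 0 <= k < 1 -> (forall x, nrm (K x) <= k * nrm x) ->
  exists x, y + K x = x.
Proof.
move=> lK /[dup] k01 /andP[k0 k1] hK.
pose u := fix u n := if n is m.+1 then y + K (u m) else 0.
have k1' : 0 < 1 - k by rewrite subr_gt0.
(* [C] solves [C = nrm y + k * C], so the ball of radius [C] is stable under the iteration. *)
pose C := nrm y / (1 - k).
have C0 : 0 <= C by rewrite divr_ge0 ?nrm_ge0 ?ltW.
have bu j : nrm (u j) <= C.
  elim: j => [|j IHj]; first by rewrite nrm0.
  rewrite (le_trans (nrmD _ _))// (@le_trans _ _ (nrm y + k * C))//.
    by rewrite lerD2l (le_trans (hK _))// ler_wpM2l.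
  by rewrite /C le_eqVlt; apply/orP; left; apply/eqP; field; rewrite gt_eqF.
have du n j : nrm (u (n + j)%N - u n) <= C * k ^+ n.
  elim: n => [|n IHn]; first by rewrite subr0 expr0 mulr1 add0n.
  rewrite addSn/= opprD addrACA subrr add0r -lin_sub//.
  by rewrite (le_trans (hK _))// exprS mulrCA ler_wpM2l.
have [|l hl] := nrm_complete (u := u).
  move=> e e0; have [N hN] := geometric_lt (2 * C) k01 e0.
  exists N => m n Nm Nn; apply: le_lt_trans hN.
  rewrite (le_trans (nrm_triangle (u N) _ _))// -mulrA mulr2n mulrDl mul1r.
  have duN j : (N <= j)%N -> nrm (u j - u N) <= C * k ^+ N.
    by move=> /subnKC <-; exact: du.
  by apply: lerD; [exact: duN | rewrite nrmB; exact: duN].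
exists l; apply/eqP; rewrite -subr_eq0 -nrm_eq0; apply/eqP/le_anti.
rewrite nrm_ge0 andbT; apply/ler_addgt0Pl => e e0; rewrite addr0.
have [N hN] := hl _ (divr_gt0 e0 (ltr0n R 2)).
rewrite (le_trans (nrm_triangle (u N.+1) _ _))// (splitr e) lerD//; last first.
  exact/ltW/hN.
rewrite /= opprD addrACA subrr add0r -lin_sub// (le_trans (hK _))//.
rewrite (le_trans (ler_piMl _ (ltW k1))) ?nrm_ge0// nrmB.
exact/ltW/hN.
Qed.

End Contraction.

Section InnerProduct.
Context {R : realType} {H : completeNormedModType R[i]}.
Context (dot : {dot H for Num.conj}) (hdot : hilbert_norm dot).
Implicit Types (x y : H) (A B T : H -> H).

Definition rdot (x y : H) : R := complex.Re (dot x y).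

Definition selfadjoint A := forall x y, dot (A x) y = dot x (A y).

Lemma dotC x y : dot x y = (dot y x)^*%C.
Proof. by rewrite hermC expr0 mul1r. Qed.

Lemma rdotC x y : rdot x y = rdot y x.
Proof. by rewrite /rdot dotC; case: (dot y x). Qed.

Lemma rdotDl x y z : rdot (x + y) z = rdot x z + rdot y z.
Proof. by rewrite /rdot linearDl raddfD. Qed.

Lemma rdotNl x y : rdot (- x) y = - rdot x y.
Proof. by rewrite /rdot linearNl raddfN. Qed.

Lemma rdotZl (a : R) x y : rdot (a%:C *: x) y = a * rdot x y.
Proof.
by rewrite /rdot linearZl_LR/=; case: (dot x y) => b c /=; rewrite mul0r subr0.
Qed.

Lemma rdotBl x y z : rdot (x - y) z = rdot x z - rdot y z.
Proof. by rewrite rdotDl rdotNl. Qed.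

Lemma rdotBr x y z : rdot z (x - y) = rdot z x - rdot z y.
Proof. by rewrite !(rdotC z) rdotBl. Qed.

Lemma rdotZr (a : R) x y : rdot y (a%:C *: x) = a * rdot y x.
Proof. by rewrite !(rdotC y) rdotZl. Qed.

Lemma rdotxx x : rdot x x = nrm x ^+ 2.
Proof. by rewrite /rdot hdot nrmE -rmorphXn. Qed.

Lemma nrm_sqrB x y : nrm (x - y) ^+ 2 = nrm x ^+ 2 - rdot x y *+ 2 + nrm y ^+ 2.
Proof.
rewrite -!rdotxx rdotBl !rdotBr (rdotC y x); ring.
Qed.

(** Cauchy-Schwarz: expand the squared norm of [|y| x - |x| y], two vectors scaled to equal
    length. *)
Lemma rdot_le x y : rdot x y <= nrm x * nrm y.
Proof.
have [->|x0] := eqVneq x 0; first by rewrite /rdot linear0l/= nrm0 mul0r.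
have [->|y0] := eqVneq y 0; first by rewrite rdotC /rdot linear0l/= nrm0 mulr0.
have nx : 0 < nrm x by rewrite lt0r nrm_eq0 x0 nrm_ge0.
have ny : 0 < nrm y by rewrite lt0r nrm_eq0 y0 nrm_ge0.
have := sqr_ge0 (nrm ((nrm y)%:C *: x - (nrm x)%:C *: y)).
rewrite nrm_sqrB !nrmZr rdotZl rdotZr !ger0_norm ?nrm_ge0//.
have -> : (nrm y * nrm x) ^+ 2 - nrm y * (nrm x * rdot x y) *+ 2 +
    (nrm x * nrm y) ^+ 2 =
    2 * (nrm x * nrm y) * (nrm x * nrm y - rdot x y) by ring.
by rewrite pmulr_rge0 ?subr_ge0// mulr_gt0// mulr_gt0.
Qed.

Lemma selfadjoint_rdot A x y : selfadjoint A -> rdot (A x) y = rdot x (A y).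
Proof. by move=> sA; rewrite /rdot sA. Qed.

Lemma rdot_opnorm_le A x : bounded_operator A ->
  rdot (A x) x <= opnorm A * nrm x ^+ 2.
Proof.
move=> bA; rewrite (le_trans (rdot_le _ _))// expr2 mulrA.
by rewrite ler_wpM2r ?nrm_ge0// le_opnorm.
Qed.

(** Polarization: the form of [A] is real at [x + y] and at [x + i y], which makes [dot (A x) y] and
    [dot (A y) x] conjugate. *)
Lemma positive_selfadjoint A : linear A -> positive_operator dot A -> selfadjoint A.
Proof.
move=> lA pA x y.
have rA z : complex.Im (dot (A z) z) = 0.
  by have := pA z; rewrite lecE => /andP[/eqP].
have e1 := rA (x + y); have e2 := rA (x + 'i%C *: y).
rewrite (dotC x).
move: e1 e2; rewrite !(lin_add lA) (lin_scale lA).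
rewrite !(linearDl, linearDr) !linearZl_LR/= !linearZr_LR/=.
have := rA x; have := rA y.
case: (dot (A x) x) => ? ?; case: (dot (A y) y) => ? ?.
case: (dot (A x) y) => a b; case: (dot (A y) x) => c d /=.
move=> -> -> e1 e2; congr Complex.
  by move: e2; lra.
by move: e1; lra.
Qed.

Lemma coercive_below T (d : R) : (forall x, d * nrm x ^+ 2 <= rdot (T x) x) ->
  forall x, d * nrm x <= nrm (T x).
Proof.
move=> hT x; have [->|x0] := eqVneq x 0; first by rewrite nrm0 mulr0 nrm_ge0.
have nx : 0 < nrm x by rewrite lt0r nrm_eq0 x0 nrm_ge0.
by rewrite -(ler_pM2r nx) -mulrA -expr2 (le_trans (hT x))// rdot_le.
Qed.

(* Lax-Milgram: [x |-> x - (d / N^2) (T x)] is a contraction when [N] bounds [T]. *)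
Lemma coercive_invertible T (d : R) : bounded_operator T -> 0 < d ->
  (forall x, d * nrm x ^+ 2 <= rdot (T x) x) -> invertible T.
Proof.
move=> bT d0 hT; have lT := bT.1.
apply: (bijective_invertible lT d0 (coercive_below hT)) => y.
have [M M0 hM] := bounded_ge0 bT.
(* Adding [d] makes the bound positive and at least [d], so that [c] below is nonnegative. *)
pose N := M + d; have N0 : 0 < N by rewrite ltr_wpDl.
have hN x : nrm (T x) <= N * nrm x.
  by rewrite (le_trans (hM x))// ler_wpM2r ?nrm_ge0// lerDl ltW.
pose a := d / N ^+ 2; have a0 : 0 < a by rewrite divr_gt0// exprn_gt0.
(* [c] is the value of [1 - 2 a d + a^2 N^2], which bounds the squared contraction factor;
   [a = d / N^2] minimizes it. *)
pose c := 1 - d ^+ 2 / N ^+ 2.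
have c0 : 0 <= c.
  rewrite subr_ge0 ler_pdivrMr ?exprn_gt0// mul1r.
  rewrite ler_sqr ?nnegrE ?(ltW d0) ?(ltW N0)//.
  by rewrite /N lerDr.
have c1 : c < 1 by rewrite gtrBl divr_gt0 ?exprn_gt0.
pose K x := x - a%:C *: T x.
have lK : linear K.
  move=> b x z; rewrite /K lT !scalerDr scalerN !scalerA opprD.
  by rewrite [b * _]mulrC addrACA.
have hK x : nrm (K x) <= Num.sqrt c * nrm x.
  rewrite -ler_sqr ?nnegrE ?mulr_ge0 ?sqrtr_ge0 ?nrm_ge0//.
  rewrite exprMn sqr_sqrtr// /K nrm_sqrB nrmZr rdotZr rdotC ger0_norm ?(ltW a0)//.
  have h1 : nrm (T x) ^+ 2 <= N ^+ 2 * nrm x ^+ 2.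
    by rewrite -exprMn ler_sqr ?nnegrE ?mulr_ge0 ?nrm_ge0 ?(ltW N0).
  have -> : c * nrm x ^+ 2 = nrm x ^+ 2 - (a * (d * nrm x ^+ 2)) *+ 2 +
      a ^+ 2 * (N ^+ 2 * nrm x ^+ 2).
    by rewrite /c /a; field; rewrite gt_eqF.
  rewrite exprMn; apply: lerD; last by rewrite ler_wpM2l ?sqr_ge0.
  by rewrite lerD2l lerN2 lerMn2r/= ler_wpM2l ?(ltW a0).
have [|x hx] := @contraction_affine_fixpoint _ _ K (Num.sqrt c) (a%:C *: y) lK _ hK.
  by rewrite sqrtr_ge0/= -[ltRHS]sqrtr1 ltr_sqrt.
exists x; apply: (@scalerI _ _ a%:C); first by rewrite fmorph_eq0 gt_eqF.
apply/eqP; rewrite eq_sym -subr_eq0; apply/eqP/(addIr x).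
by rewrite add0r -[RHS]hx /K addrAC addrA.
Qed.

End InnerProduct.

(** * Polynomials of a self-adjoint operator *)

Section PolynomialCalculus.
Context {K : comNzRingType} {V : lmodType K}.
Implicit Types (A : V -> V) (p q : {poly K}) (x : V).

(** Allowing coefficients in any commutative ring makes it possible to split a real polynomial into
    linear factors over [R[i]]. *)
Definition horner_op p A x : V := \sum_(i < size p) p`_i *: iter i A x.

Lemma horner_opE n p A x : (size p <= n)%N ->
  horner_op p A x = \sum_(i < n) p`_i *: iter i A x.
Proof.
move=> pn; rewrite /horner_op -!(big_mkord xpredT (fun i => p`_i *: iter i A x)).
rewrite [RHS](big_cat_nat (n := size p))//= [X in _ + X]big_nat_cond.
rewrite [X in _ + X]big1 ?addr0// => i /andP[/andP[pi _] _].
by rewrite nth_default// scale0r.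
Qed.

Lemma horner_opD p q A x :
  horner_op (p + q) A x = horner_op p A x + horner_op q A x.
Proof.
pose n := maxn (size p) (size q).
rewrite !(@horner_opE n) ?leq_maxl ?leq_maxr ?size_polyD// -big_split/=.
by apply: eq_bigr => i _; rewrite coefD scalerDl.
Qed.

Lemma horner_opZ (c : K) p A x : horner_op (c *: p) A x = c *: horner_op p A x.
Proof.
rewrite (@horner_opE (size p)) ?size_scale_leq// /horner_op scaler_sumr.
by apply: eq_bigr => i _; rewrite coefZ scalerA.
Qed.

Lemma horner_opC (c : K) A x : horner_op c%:P A x = c *: x.
Proof.
by rewrite (@horner_opE 1) ?size_polyC_leq1// big_ord1 coefC.
Qed.

Lemma horner_opXM p A x : linear A -> horner_op ('X * p) A x = A (horner_op p A x).
Proof.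
move=> lA; rewrite (@horner_opE (size p).+1).
  rewrite big_ord_recl coefXM scale0r add0r /horner_op lin_sum//.
  by apply: eq_bigr => i _; rewrite coefXM/= lin_scale.
have [->|p0] := eqVneq p 0; first by rewrite mulr0 size_poly0.
by rewrite mulrC size_mulX.
Qed.

Lemma horner_opM p q A x : linear A ->
  horner_op (p * q) A x = horner_op p A (horner_op q A x).
Proof.
move=> lA; elim/poly_ind: p x => [|p c IHp] x.
  by rewrite mul0r -polyC0 !horner_opC !scale0r.
rewrite mulrDl mulrAC -mulrA [q * _]mulrC mulrA.
rewrite !horner_opD mul_polyC horner_opZ horner_opC ![_ * 'X]mulrC -mulrA.
by rewrite !horner_opXM// IHp.
Qed.

Lemma horner_opX A x : linear A -> horner_op 'X A x = A x.
Proof.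
by move=> lA; rewrite -[X in horner_op X]mulr1 horner_opXM// horner_opC scale1r.
Qed.

End PolynomialCalculus.

Section RealPolynomials.
Context {R : realType} {H : completeNormedModType R[i]}.
Implicit Types (A T : H -> H) (p q : {poly R}) (x : H).

Lemma poly_op_horner_op p A x :
  poly_op p A x = horner_op (map_poly (real_complex R) p) A x.
Proof.
rewrite /poly_op fct_sumE /horner_op size_map_poly.
by apply: eq_bigr => i _; rewrite !fctE coef_map.
Qed.

Lemma poly_opD p q A : poly_op (p + q) A = poly_op p A + poly_op q A.
Proof.
by apply/funext => x; rewrite fctE !poly_op_horner_op rmorphD horner_opD.
Qed.

Lemma poly_opZ (c : R) p A x : poly_op (c *: p) A x = c%:C *: poly_op p A x.
Proof. by rewrite !poly_op_horner_op map_polyZ horner_opZ. Qed.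

Lemma poly_opN p A : poly_op (- p) A = - poly_op p A.
Proof. by apply/funext => x; rewrite -scaleN1r poly_opZ fctE rmorphN1 scaleN1r. Qed.

Lemma poly_opB p q A : poly_op (p - q) A = poly_op p A - poly_op q A.
Proof. by rewrite poly_opD poly_opN. Qed.

Lemma poly_opC (c : R) A x : poly_op c%:P A x = c%:C *: x.
Proof. by rewrite poly_op_horner_op map_polyC horner_opC. Qed.

Lemma poly_opX A : linear A -> poly_op 'X A = A.
Proof.
by move=> lA; apply/funext => x; rewrite poly_op_horner_op map_polyX horner_opX.
Qed.

Lemma poly_opM p q A : linear A -> poly_op (p * q) A = poly_op p A \o poly_op q A.
Proof.
by move=> lA; apply/funext => x; rewrite /= !poly_op_horner_op rmorphM horner_opM.
Qed.

Lemma poly_op_XsubC A (t : R) : linear A ->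
  poly_op ('X - t%:P) A = A - (fun x => t%:C *: x).
Proof.
by move=> lA; apply/funext => x; rewrite poly_opB poly_opX// !fctE poly_opC.
Qed.

Lemma poly_op_comm p q A : linear A ->
  poly_op p A \o poly_op q A = poly_op q A \o poly_op p A.
Proof. by move=> lA; rewrite -!poly_opM// mulrC. Qed.

Lemma bounded_poly_op p A : bounded_operator A -> bounded_operator (poly_op p A).
Proof.
move=> bA; apply: bounded_sum => i; apply: bounded_scale; exact: bounded_iter.
Qed.

Lemma opnormN T : opnorm (- T) = opnorm T.
Proof.
by rewrite /opnorm; congr sup; apply/seteqP; split=> _ [x x1 <-];
   exists x => //; rewrite fctE normrN.
Qed.

End RealPolynomials.

(** * Spectrum and norm of real polynomials in a self-adjoint operator *)

Section SpectralTheory.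
Context {R : realType} {H : completeNormedModType R[i]}.
Context (dot : {dot H for Num.conj}) (hdot : hilbert_norm dot).
Implicit Types (A T : H -> H) (p q : {poly R}) (x y : H).

Lemma selfadjoint_poly_op p A : selfadjoint dot A ->
  selfadjoint dot (poly_op p A).
Proof.
move=> sA; rewrite /poly_op; apply: big_ind.
- by move=> x y; rewrite linear0l linear0r.
- move=> S T sS sT x y; rewrite !fctE linearDl linearDr.
  by congr (_ + _); [exact: sS|exact: sT].
move=> i _ x y; rewrite !fctE linearZl_LR/= linearZr_LR/=; congr (_ * _).
  exact/esym/conjc_real.
elim: (nat_of_ord i) x y => //= n IHn x y.
by rewrite sA IHn -iterSr.
Qed.

(** If [p.[t]] exceeded the norm, [p.[t] - p(A)] would be coercive, hence invertible; but [A - t] is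
    one of its commuting factors. *)
Lemma le_spectrum_poly_op A p (t : R) : bounded_operator A ->
  selfadjoint dot A ->
  real_spectrum A t -> p.[t] <= opnorm (poly_op p A).
Proof.
move=> bA sA specA; rewrite leNgt; apply/negP => lt_p; apply: specA.
have lA := bA.1.
pose q := (p.[t])%:P - p.
have /factor_theorem[g qg] : root q t by rewrite /root !hornerE subrr.
have bq r : bounded_operator (poly_op r A) by exact: bounded_poly_op.
rewrite -poly_op_XsubC//.
apply: (@invertible_factor _ _ _ (poly_op g A)) => //; first exact: poly_op_comm.
rewrite -poly_opM// mulrC -qg.
apply: (@coercive_invertible _ _ _ hdot _ (p.[t] - opnorm (poly_op p A))) => //.
  by rewrite subr_gt0.
move=> x; rewrite poly_opB fctE poly_opC rdotBl rdotZl (rdotxx hdot) mulrBl.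
by rewrite lerD2l lerN2 rdot_opnorm_le.
Qed.

Lemma spectrum_poly_op_le A p (t : R) : bounded_operator A ->
  selfadjoint dot A ->
  real_spectrum A t -> `|p.[t]| <= opnorm (poly_op p A).
Proof.
move=> bA sA specA; rewrite ler_norml le_spectrum_poly_op// andbT lerNl.
by rewrite -hornerN -opnormN -poly_opN le_spectrum_poly_op.
Qed.

(** For [t < m] the operator [A - t] is coercive with constant [m - t]. *)
Lemma spectrum_ge A (t m : R) : bounded_operator A ->
  (forall x, m * nrm x ^+ 2 <= rdot dot (A x) x) ->
  real_spectrum A t -> m <= t.
Proof.
move=> bA hm specA; rewrite leNgt; apply/negP => tm; apply: specA.
rewrite -poly_op_XsubC; last by case: bA.
apply: (@coercive_invertible _ _ _ hdot _ (m - t)).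
- exact: bounded_poly_op.
- by rewrite subr_gt0.
move=> x; rewrite poly_op_XsubC; last by case: bA.
by rewrite !fctE rdotBl rdotZl (rdotxx hdot) mulrBl lerD2r.
Qed.

(** Unlike invertibility, this can be refuted by approximate eigenvectors alone, and it passes to
    products at once. *)
Definition bounded_below T :=
  exists2 c : R, 0 < c & forall x, c * nrm x <= nrm (T x).

Lemma invertible_bounded_below T : linear T -> invertible T -> bounded_below T.
Proof.
move=> lT [J [bJ _ JT]]; have [M M0 hM] := bounded_ge0 bJ.
have M1 : 0 < M + 1 by rewrite ltr_wpDl.
exists (M + 1)^-1; first by rewrite invr_gt0.
move=> x; rewrite mulrC ler_pdivrMr//.
have /= {1}<- := congr1 (@^~ x) JT; rewrite (le_trans (hM _))// mulrC.
by rewrite ler_wpM2l ?nrm_ge0// lerDl.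
Qed.

(** With [z = a + i b], the square of [|(A - z) x|] is that of [|(A - a) x|] plus [b^2 |x|^2]: the
    cross term vanishes because the form of [A - a] is real. *)
Lemma selfadjoint_shift_below A (z : R[i]) : selfadjoint dot A ->
  complex.Im z != 0 -> bounded_below (fun x => A x - z *: x).
Proof.
move=> sA; case: z => a b /= b0; exists `|b|; first by rewrite normr_gt0.
move=> x; rewrite -ler_sqr ?nnegrE ?mulr_ge0 ?nrm_ge0// exprMn real_normK ?num_real//.
have -> : A x - (a +i* b) *: x = (A x - a%:C *: x) - ('i%C * b%:C) *: x.
  rewrite -addrA -opprD -scalerDl; congr (_ - _ *: _).
  by apply/eqP; rewrite eq_complex/=; apply/andP; split; apply/eqP; ring.
rewrite (nrm_sqrB hdot).
have -> : rdot dot (A x - a%:C *: x) (('i%C * b%:C) *: x) = 0.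
  rewrite /rdot linearZr_LR linearBl linearZl_LR/= hdot nrmE.
  have : complex.Im (dot (A x) x) = 0.
    by have := dotC dot (A x) x; rewrite -sA; case: (dot (A x) x) => u v [] /=; lra.
  case: (dot (A x) x) => u v /= ->; ring.
rewrite mul0rn subr0 nrmZ.
have -> : complex.Re `|'i%C * b%:C| = `|b|.
  by rewrite normc_def/= -[RHS]sqrtr_sqr; congr Num.sqrt; ring.
by rewrite exprMn real_normK ?num_real// lerDr sqr_ge0.
Qed.

Lemma bounded_below_prod A (r : seq R[i]) : linear A ->
  (forall z, z \in r -> bounded_below (fun x => A x - z *: x)) ->
  bounded_below (horner_op (\prod_(z <- r) ('X - z%:P)) A).
Proof.
move=> lA; elim: r => [|z r IHr] hr.
  exists 1 => // x; rewrite big_nil -polyC1 horner_opC scale1r mul1r//.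
have [c c0 hc] := IHr (fun w wr => hr w (mem_behead (s := z :: r) wr)).
have [d d0 hd] := hr z (mem_head _ _).
exists (d * c); first exact: mulr_gt0.
move=> x; rewrite big_cons horner_opM// horner_opD horner_opX// -polyCN.
rewrite horner_opC scaleNr.
by apply: le_trans (hd _); rewrite -mulrA ler_pM2l.
Qed.

Context (Hnz : exists x : H, x != 0).

(** A lower bound [c] for [T^2 - s^2] would give [|T x|^2 <= (s^2 - c^2 / s^2) |x|^2], making the
    norm of [T] smaller than [s]. *)
Lemma sqr_sub_opnorm_not_below T : bounded_operator T -> selfadjoint dot T ->
  ~ bounded_below (fun x => T (T x) - (opnorm T ^+ 2)%:C *: x).
Proof.
move=> bT sT [c c0 hc]; set s := opnorm T in hc.
have s0 : 0 <= s by exact: opnorm_ge0.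
(* Expand the square of [|T^2 x - s^2 x|]; self-adjointness turns the cross term into
   [-2 s^2 |T x|^2], half of which absorbs [|T^2 x|^2]. *)
have key x : c ^+ 2 * nrm x ^+ 2 + s ^+ 2 * nrm (T x) ^+ 2 <= s ^+ 4 * nrm x ^+ 2.
  have : (c * nrm x) ^+ 2 <= nrm (T (T x) - (s ^+ 2)%:C *: x) ^+ 2.
    by rewrite ler_sqr ?nnegrE ?mulr_ge0 ?nrm_ge0 ?(ltW c0).
  rewrite (nrm_sqrB hdot) nrmZr rdotZr selfadjoint_rdot// (rdotxx hdot).
  rewrite ger0_norm ?sqr_ge0//.
  have : nrm (T (T x)) ^+ 2 <= s ^+ 2 * nrm (T x) ^+ 2.
    by rewrite -exprMn ler_sqr ?nnegrE ?mulr_ge0 ?nrm_ge0// le_opnorm.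
  move: (nrm (T (T x))) (nrm (T x)) (nrm x) => a b d; lra.
have [x0 x00] := Hnz.
have n0 : 0 < nrm x0 ^+ 2 by rewrite exprn_gt0// lt0r nrm_eq0 x00 nrm_ge0.
have c2 : 0 < c ^+ 2 by rewrite exprn_gt0.
(* For [s = 0] the estimate at [x0] already reads [c^2 |x0|^2 <= 0]; otherwise one may divide by
   [s^2]. *)
have [s1|s1] := eqVneq s 0.
  have := key x0; rewrite s1 !expr0n/= !mul0r addr0 leNgt mulr_gt0//.
have s2 : 0 < s by rewrite lt0r s1.
pose k := s ^+ 2 - c ^+ 2 / s ^+ 2.
have hk x : nrm (T x) ^+ 2 <= k * nrm x ^+ 2.
  rewrite -(ler_pM2l (exprn_gt0 2 s2)) /k.
  have -> : s ^+ 2 * ((s ^+ 2 - c ^+ 2 / s ^+ 2) * nrm x ^+ 2) =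
    s ^+ 4 * nrm x ^+ 2 - c ^+ 2 * nrm x ^+ 2 by field.
  by rewrite lerBrDl.
have k0 : 0 <= k.
  by rewrite -(pmulr_lge0 _ n0) (le_trans _ (hk x0))// sqr_ge0.
have : s <= Num.sqrt k.
  apply: opnorm_le; first exact: sqrtr_ge0.
  move=> x; rewrite -ler_sqr ?nnegrE ?mulr_ge0 ?sqrtr_ge0 ?nrm_ge0//.
  by rewrite exprMn sqr_sqrtr.
rewrite -ler_sqr ?nnegrE ?sqrtr_ge0// sqr_sqrtr// /k.
by rewrite leNgt gtrBl divr_gt0// exprn_gt0.
Qed.

Lemma spectrum_poly_op_attained_nonconst A p : bounded_operator A ->
  selfadjoint dot A -> (1 < size p)%N ->
  exists2 t, real_spectrum A t & `|p.[t]| = opnorm (poly_op p A).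
Proof.
move=> bA sA p1; have lA := bA.1.
set T := poly_op p A; set s := opnorm T.
have bT : bounded_operator T by exact: bounded_poly_op.
have sT : selfadjoint dot T by exact: selfadjoint_poly_op.
have s0 : 0 <= s by exact: opnorm_ge0.
pose P := p * p - (s ^+ 2)%:P.
(* Here [p] must be nonconstant: [p * p] then has size at least 3 and is not a constant. *)
have P0 : P != 0.
  apply/eqP => /eqP; rewrite subr_eq0 => /eqP /(congr1 (fun q : {poly R} => size q)).
  have pn0 : p != 0 by rewrite -size_poly_gt0 (ltn_trans _ p1).
  rewrite size_mul// => szP; have := size_polyC_leq1 (s ^+ 2); rewrite -szP.
  by case: (size p) p1 => [|[|n]]; rewrite // addSn addnS.
apply: contrapT => hno; apply: (sqr_sub_opnorm_not_below bT sT).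
have [r Pr] := closed_field_poly_normal (map_poly (real_complex R) P).
set l := lead_coef _ in Pr.
have l0 : l != 0 by rewrite lead_coef_eq0 map_poly_eq0.
(* Every root [z] of [P] gives a factor bounded below: if [z] is not real, by the shift lemma; if
   real, then [|p.[z]| = s], so by assumption [z] is outside the spectrum. *)
have [|c c0 hc] := @bounded_below_prod A r lA.
  move=> z zr; have [z0|] := eqVneq (complex.Im z) 0; last first.
    exact: selfadjoint_shift_below.
  have zE : z = (complex.Re z)%:C by case: z z0 {zr} => a b /= ->.
  have : root (map_poly (real_complex R) P) z by rewrite Pr rootZ// root_prod_XsubC.
  rewrite zE /root horner_map fmorph_eq0 !hornerE -expr2 subr_eq0 => pz.
  apply: invertible_bounded_below.
    by move=> a x y; rewrite lA scalerDr scalerBr opprD addrACA !scalerA mulrC.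
  apply: contrapT => specz; apply: hno; exists (complex.Re z) => //.
  by apply/eqP; rewrite -(@eqrXn2 _ 2)// real_normK ?num_real.
exists (complex.Re `|l| * c).
  by rewrite mulr_gt0// -ltcR RRe_real ?normr_real// normr_gt0.
move=> x; rewrite -/s.
have -> : T (T x) - (s ^+ 2)%:C *: x =
    l *: horner_op (\prod_(z <- r) ('X - z%:P)) A x.
  rewrite -horner_opZ -Pr -poly_op_horner_op /P poly_opB poly_opM//.
  by rewrite !fctE/= poly_opC.
by rewrite nrmZ -mulrA ler_wpM2l// normc_def/= sqrtr_ge0.
Qed.

Lemma spectrum_poly_op_attained A p : bounded_operator A -> selfadjoint dot A ->
  exists2 t, real_spectrum A t & `|p.[t]| = opnorm (poly_op p A).
Proof.
move=> bA sA; have [p1|] := ltnP 1 (size p).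
  exact: spectrum_poly_op_attained_nonconst.
move=> /size1_polyC pE.
(* For a constant [p] any spectral point will do; the case of ['X] shows that the spectrum is
   nonempty. *)
have [|t tA _] := @spectrum_poly_op_attained_nonconst A 'X bA sA.
  by rewrite size_polyX.
exists t => //; apply/le_anti; rewrite spectrum_poly_op_le//= pE hornerC.
by apply: opnorm_le => // x; rewrite poly_opC nrmZr.
Qed.

(** The norm of [N - A], with [N] the norm of [A], is attained at a spectral point [t] as [N - t];
    hence the form of [N - A] is at most [N - t]. The upper bound uses [A + N] in the same way. *)
Lemma spectrum_lower_bound A : bounded_operator A -> selfadjoint dot A ->
  exists2 t, real_spectrum A t &
    forall x, t * nrm x ^+ 2 <= rdot dot (A x) x.
Proof.
move=> bA sA; have lA := bA.1; set N := opnorm A.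
have [t tA tN] := @spectrum_poly_op_attained A (N%:P - 'X) bA sA.
exists t => // x.
have tleN : t <= N.
  by have := le_spectrum_poly_op 'X bA sA tA; rewrite hornerX poly_opX.
have := @rdot_opnorm_le _ _ _ hdot _ x (bounded_poly_op (N%:P - 'X) bA).
rewrite -tN hornerD hornerN hornerC hornerX ger0_norm ?subr_ge0//.
rewrite poly_opB fctE poly_opC poly_opX//.
rewrite rdotBl rdotZl (rdotxx hdot); lra.
Qed.

Lemma spectrum_upper_bound A : bounded_operator A -> selfadjoint dot A ->
  exists2 t, real_spectrum A t &
    forall x, rdot dot (A x) x <= t * nrm x ^+ 2.
Proof.
move=> bA sA; have lA := bA.1; set N := opnorm A.
have [t tA tN] := @spectrum_poly_op_attained A ('X + N%:P) bA sA.
exists t => // x.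
have tgeN : 0 <= t + N.
  have := spectrum_poly_op_le 'X bA sA tA; rewrite hornerX poly_opX// ler_norml.
  by rewrite -/N => /andP[+ _]; lra.
have := @rdot_opnorm_le _ _ _ hdot _ x (bounded_poly_op ('X + N%:P) bA).
rewrite -tN hornerD hornerC hornerX ger0_norm// poly_opD fctE poly_opC poly_opX//.
rewrite rdotDl rdotZl (rdotxx hdot); lra.
Qed.

End SpectralTheory.

(** * Functional calculus *)

Lemma cvg_uniformP (R : realType) (S : set R) (F : nat -> R -> R) (f : R -> R) :
  {uniform S, F @ \oo --> f} <->
  forall e : R, 0 < e -> exists N, forall n, (N <= n)%N ->
    forall t, S t -> `|F n t - f t| < e.
Proof.
split=> [Ff e e0|Ff P /uniform_nbhs[E [entE EP]]].
  have [|N _ NP] := Ff [set h | forall y, S y -> `|f y - h y| < e].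
    apply/uniform_nbhs; exists [set xy | `|xy.1 - xy.2| < e]; split=> //.
    by rewrite -entourage_ballE; exists e => // -[a b].
  by exists N => n Nn t St; rewrite distrC; exact: NP.
move: entE; rewrite -entourage_ballE => -[e /= e0 eE].
have [N NP] := Ff e e0; exists N => // n /= Nn; apply: EP => y Sy.
by apply: eE => /=; rewrite /ball/= distrC; exact: NP.
Qed.

Lemma cvg_seq0P (R : realType) (u : nat -> R) : (forall n, 0 <= u n) ->
  u n @[n --> \oo] --> (0 : R) <->
  forall e : R, 0 < e -> exists N, forall n, (N <= n)%N -> u n < e.
Proof.
move=> u0; split=> [/cvgrPdist_lt ul e /ul[N _ NP]|ul].
  exists N => n /NP/=; rewrite sub0r normrN; apply: le_lt_trans.
  exact: ler_norm.
apply/cvgrPdist_lt => e /ul[N NP]; exists N => // n /= /NP.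
by rewrite sub0r normrN ger0_norm.
Qed.

Section FunctionalCalculus.
Context {R : realType} {H : completeNormedModType R[i]}.
Context (dot : {dot H for Num.conj}) (hdot : hilbert_norm dot).
Implicit Types (A T : H -> H) (p q : {poly R}) (x y : H) (f : R -> R).

Lemma nrm_small_eq0 (x : H) (C : R) : (forall e, 0 < e -> nrm x <= e * C) -> x = 0.
Proof.
move=> hx; apply/eqP; rewrite -nrm_eq0; apply/eqP/le_anti.
rewrite nrm_ge0 andbT; apply/ler_addgt0Pl => e e0; rewrite addr0.
have C1 : 0 < `|C| + 1 by rewrite ltr_wpDl.
apply: le_trans (hx _ (divr_gt0 e0 C1)) _.
by rewrite mulrAC ler_pdivrMr// ler_wpM2l ?(ltW e0)//
  (le_trans (ler_norm _))// lerDl.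
Qed.

Lemma is_cfcP A f T : bounded_operator A -> is_cfc f A T <->
  bounded_operator T /\ exists p : nat -> {poly R},
    (forall e : R, 0 < e -> exists N, forall n, (N <= n)%N ->
       forall t, real_spectrum A t -> `|(p n).[t] - f t| < e) /\
    (forall e : R, 0 < e -> exists N, forall n, (N <= n)%N ->
       opnorm (poly_op (p n) A - T) < e).
Proof.
move=> bA; split=> -[bT [p [pf pT]]]; split=> //; exists p.
  split; first exact/cvg_uniformP.
  apply/cvg_seq0P => // n; apply: opnorm_ge0.
  by apply: bounded_sub => //; exact: bounded_poly_op.
split; first exact/cvg_uniformP.
apply/cvg_seq0P => // n; apply: opnorm_ge0.
by apply: bounded_sub => //; exact: bounded_poly_op.
Qed.

Lemma selfadjoint_limit T : linear T ->
  (forall e : R, 0 < e -> exists2 S, selfadjoint dot S &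
     forall x, nrm (S x - T x) <= e * nrm x) ->
  selfadjoint dot T.
Proof.
move=> lT hT.
have rT x y : rdot dot (T x) y = rdot dot x (T y).
  apply/eqP; rewrite -subr_eq0 -normr_eq0; apply/eqP/le_anti.
  rewrite normr_ge0 andbT; apply/ler_addgt0Pl => e e0; rewrite addr0.
  (* Two errors, each at most [e / c * (|x| |y|)], must add up to at most [e]; the added 1 keeps [c]
     positive. *)
  pose c := 2 * (nrm x * nrm y) + 1.
  have c0 : 0 < c by rewrite ltr_wpDl// mulr_ge0// mulr_ge0 ?nrm_ge0.
  have [S sS ST] := hT _ (divr_gt0 e0 c0).
  have b1 : `|rdot dot (S x - T x) y| <= e / c * (nrm x * nrm y).
    have := ST x; rewrite mulrA => h.
    have hh : nrm (S x - T x) * nrm y <= e / c * nrm x * nrm y.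
      by rewrite ler_wpM2r ?nrm_ge0.
    rewrite ler_norml; apply/andP; split.
      rewrite lerNl -rdotNl; apply: le_trans hh.
      by rewrite (le_trans (rdot_le hdot _ _))// nrmN.
    by apply: le_trans hh; exact: rdot_le.
  have b2 : `|rdot dot x (S y - T y)| <= e / c * (nrm x * nrm y).
    have h := ST y.
    have hh : nrm x * nrm (S y - T y) <= e / c * (nrm x * nrm y).
      by rewrite mulrCA ler_wpM2l ?nrm_ge0.
    rewrite ler_norml; apply/andP; split.
      rewrite lerNl rdotC -rdotNl; apply: le_trans hh.
      by rewrite rdotC (le_trans (rdot_le hdot _ _))// nrmN.
    by apply: le_trans hh; exact: rdot_le.
  have -> : rdot dot (T x) y - rdot dot x (T y) =
    rdot dot x (S y - T y) - rdot dot (S x - T x) y.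
    by rewrite rdotBr rdotBl (selfadjoint_rdot x y sS); ring.
  rewrite (le_trans (ler_normB _ _))// (le_trans (lerD b2 b1))//.
  rewrite -mulrDr mulrAC ler_pdivrMr// ler_wpM2l ?(ltW e0)//.
  by rewrite /c mulr2n mulrDl mul1r lerDl.
(* Testing against ['i y] recovers the imaginary part of the inner product. *)
move=> x y; have r1 := rT x y; have r2 := rT x ('i%C *: y).
move: r1 r2; rewrite /rdot lin_scale// !linearZr_LR/=.
case: (dot (T x) y) => a b; case: (dot x (T y)) => c d /= -> h.
by congr Complex; lra.
Qed.

(** A single polynomial, of index the larger of the two thresholds, serves both for [f] on the
    spectrum and for [T] in norm. *)
Lemma is_cfc_approx A f T : bounded_operator A -> is_cfc f A T ->
  forall e : R, 0 < e -> exists p,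
    [/\ forall t, real_spectrum A t -> `|p.[t] - f t| < e,
        forall x, nrm (poly_op p A x - T x) <= e * nrm x &
        opnorm (poly_op p A - T) < e].
Proof.
move=> bA /(is_cfcP f T bA)[bT [p [pf pT]]] e e0.
have [N1 h1] := pf e e0; have [N2 h2] := pT e e0.
pose n := maxn N1 N2; exists (p n).
have hn : opnorm (poly_op (p n) A - T) < e by rewrite h2// leq_maxr.
split=> //; first by apply: h1; rewrite leq_maxl.
move=> x; have bd : bounded_operator (poly_op (p n) A - T).
  by apply: bounded_sub => //; exact: bounded_poly_op.
rewrite (le_trans (le_opnorm bd x))// ler_wpM2r ?nrm_ge0//; exact: ltW.
Qed.

Lemma is_cfc_selfadjoint A f T : bounded_operator A -> selfadjoint dot A ->
  is_cfc f A T -> selfadjoint dot T.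
Proof.
move=> bA sA cT; apply: selfadjoint_limit; first by case: cT => -[].
move=> e e0; have [p [_ pT _]] := is_cfc_approx bA cT e0.
by exists (poly_op p A) => //; exact: selfadjoint_poly_op.
Qed.

Lemma opnorm_triangle A B : bounded_operator A -> bounded_operator B ->
  opnorm (A + B) <= opnorm A + opnorm B.
Proof.
move=> bA bB; apply: opnorm_le; first by rewrite addr_ge0// opnorm_ge0.
move=> x; rewrite fctE (le_trans (nrmD _ _))// mulrDl.
by rewrite lerD// le_opnorm.
Qed.

(** The bound of [|p.[t]|] by the norm of [p(A)] passes to the limit, half of [e] going to each
    approximation. *)
Lemma spectrum_cfc_le A f T (t : R) : bounded_operator A -> selfadjoint dot A ->
  is_cfc f A T -> real_spectrum A t -> `|f t| <= opnorm T.
Proof.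
move=> bA sA cT tA; apply/ler_addgt0Pl => e e0.
have [p [pf _ pT]] := is_cfc_approx bA cT (divr_gt0 e0 (ltr0n _ 2)).
have bT := cT.1; have bp := bounded_poly_op p bA.
have h1 := spectrum_poly_op_le hdot p bA sA tA.
have h2 : opnorm (poly_op p A) <= opnorm (poly_op p A - T) + opnorm T.
  rewrite -{1}(subrK T (poly_op p A)) opnorm_triangle//.
  exact: bounded_sub.
have h3 : `|f t| <= `|p.[t]| + `|p.[t] - f t|.
  by rewrite -{1}(subKr p.[t] (f t)) ler_normB.
have := pf t tA; move: h1 h2 h3 pT; lra.
Qed.

Context (Hnz : exists x : H, x != 0).

(** The norm of a polynomial in [A] is its maximum on the spectrum, so uniform convergence there
    makes the operators Cauchy in norm. The limit is taken vector by vector, then shown to be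
    uniform, bounded and linear. *)
Lemma cfc_exists A f (p : nat -> {poly R}) : bounded_operator A ->
  selfadjoint dot A ->
  (forall e : R, 0 < e -> exists N, forall n, (N <= n)%N ->
       forall t, real_spectrum A t -> `|(p n).[t] - f t| < e) ->
  is_cfc f A (cfc f A).
Proof.
move=> bA sA pf.
suff [T hT] : exists T, is_cfc f A T.
  by apply: (@xgetPex _ _ [set T | is_cfc f A T]); exists T.
have cauchy e : 0 < e -> exists N, forall m n, (N <= m)%N -> (N <= n)%N ->
    forall x, nrm (poly_op (p m) A x - poly_op (p n) A x) <= e * nrm x.
  move=> e0; have [N NP] := pf _ (divr_gt0 e0 (ltr0n R 2)).
  exists N => m n Nm Nn x.
  have -> : poly_op (p m) A x - poly_op (p n) A x = poly_op (p m - p n) A x.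
    by rewrite poly_opB.
  have [t tA tE] := spectrum_poly_op_attained hdot Hnz (p m - p n) bA sA.
  rewrite (le_trans (le_opnorm (bounded_poly_op _ bA) x))// ler_wpM2r ?nrm_ge0//.
  rewrite -tE hornerD hornerN.
  have := NP m Nm t tA; have := NP n Nn t tA.
  have -> : (p m).[t] - (p n).[t] = ((p m).[t] - f t) - ((p n).[t] - f t) by ring.
  have := ler_normB ((p m).[t] - f t) ((p n).[t] - f t); lra.
have /choice[T hT] : forall x, exists l, forall e : R, 0 < e ->
    exists N, forall n, (N <= n)%N -> nrm (poly_op (p n) A x - l) < e.
  move=> x; apply: nrm_complete => e e0.
  have x1 : 0 < nrm x + 1 by rewrite ltr_wpDl// nrm_ge0.
  have [N NP] := cauchy _ (divr_gt0 e0 x1); exists N => m n Nm Nn.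
  apply: le_lt_trans (NP m n Nm Nn x) _.
  by rewrite mulrAC ltr_pdivrMr// ltr_pM2l// ltrDl.
(* The index [maxn N M] may depend on [x], but only [N] survives in the conclusion. *)
have unif e : 0 < e -> exists N, forall n, (N <= n)%N ->
    forall x, nrm (poly_op (p n) A x - T x) <= e * nrm x.
  move=> e0; have [N NP] := cauchy e e0; exists N => n Nn x.
  apply/ler_addgt0Pl => d d0; have [M MP] := hT x d d0.
  rewrite (le_trans (nrm_triangle (poly_op (p (maxn N M)) A x) _ _))//.
  rewrite addrC lerD//; first exact/ltW/MP/leq_maxr.
  by apply: NP => //; exact: leq_maxl.
exists T; apply/is_cfcP => //; split; last first.
  exists p; split=> // e e0; have [N NP] := unif _ (divr_gt0 e0 (ltr0n R 2)).
  exists N => n Nn; rewrite (@le_lt_trans _ _ (e / 2))//; last by lra.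
  by apply: opnorm_le => [|x]; [lra|exact: NP].
have [N NP] := unif 1 ltr01.
have bpN : bounded_operator (poly_op (p N) A) by exact: bounded_poly_op.
apply/bounded_operatorP; split; last first.
  exists (1 + opnorm (poly_op (p N) A)) => x.
  rewrite -[T x](subKr (poly_op (p N) A x)) addrC.
  rewrite (le_trans (nrmD _ _))// nrmN mulrDl lerD//; first exact: NP.
  exact: le_opnorm.
move=> a x y; apply/eqP; rewrite -subr_eq0; apply/eqP.
pose c := complex.Re `|a|.
have c0 : 0 <= c by rewrite /c normc_def/= sqrtr_ge0.
apply: (@nrm_small_eq0 _ (nrm (a *: x + y) + c * nrm x + nrm y)) => e e0.
have [M MP] := unif e e0; have hM := MP M (leqnn M).
set P := poly_op (p M) A in hM.
have lP : linear P by case: (bounded_poly_op (p M) bA).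
(* As [P] is linear, the linearity defect of [T] is a combination of three approximation errors. *)
have -> : T (a *: x + y) - (a *: T x + T y) =
  (a *: (P x - T x) + (P y - T y)) - (P (a *: x + y) - T (a *: x + y)).
  rewrite lP scalerBr opprB [X in _ = X + _]addrACA -opprD.
  by rewrite [RHS]addrC addrA subrK.
rewrite (le_trans (nrmD _ _))// nrmN addrC !mulrDr -addrA lerD//.
rewrite (le_trans (nrmD _ _))// nrmZ lerD// mulrCA ler_wpM2l//.
Qed.

End FunctionalCalculus.

(** * Polynomial approximation of the logarithm and of the inverse square root *)

Section PolynomialApproximation.
Context {R : realType}.
Implicit Types (m M t e : R).

(* Taylor polynomials of [ln] at [M]. *)
Fixpoint ln_poly M n : {poly R} :=
  if n is k.+1 then ln_poly M k - (k.+1%:R)^-1 *: (1 - M^-1 *: 'X) ^+ k.+1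
  else (ln M)%:P.

Lemma ln_poly_end M n : M != 0 -> (ln_poly M n).[M] = ln M.
Proof.
move=> M0; elim: n => [|n IHn] /=; first by rewrite hornerC.
rewrite hornerD hornerN hornerZ horner_exp IHn.
rewrite hornerD hornerN hornerZ hornerX hornerC.
by rewrite mulVf// subrr expr0n/= mulr0 subr0.
Qed.

(** The derivative is a finite geometric series of ratio [1 - t / M]. *)
Lemma deriv_ln_poly M n t : t != 0 -> M != 0 ->
  (ln_poly M n)^`().[t] = (1 - (1 - t / M) ^+ n) / t.
Proof.
move=> t0 M0; elim: n => [|n IHn] /=.
  by rewrite derivC horner0 expr0 subrr mul0r.
rewrite derivB hornerD hornerN IHn derivZ hornerZ deriv_exp hornerMn hornerM.
rewrite horner_exp derivB derivZ derivX -polyC1 derivC !hornerE/=.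
rewrite -(mulr_natl (- M^-1 * _)) mulKf ?pnatr_eq0// exprS.
by rewrite (mulrC M^-1 t); field; rewrite t0.
Qed.

(** Mean value theorem on [[t, M]]: the error vanishes at [M], and its derivative at [c] is
    [- (1 - c / M)^n / c]. *)
Lemma ln_poly_approx m M n t : 0 < m -> m <= t <= M ->
  `|(ln_poly M n).[t] - ln t| <= M / m * (1 - m / M) ^+ n.
Proof.
move=> m0 /andP[mt tM]; have t0 : 0 < t by exact: lt_le_trans mt.
have M0 : 0 < M by exact: lt_le_trans tM.
pose g := fun x : R => (ln_poly M n).[x] - ln x.
have dg (x : R) : 0 < x -> is_derive x 1 g ((1 - (1 - x / M) ^+ n) / x - x^-1).
  move=> x0; rewrite -deriv_ln_poly ?gt_eqF//; apply: is_deriveB.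
  exact: is_derive1_ln.
have [||c] := @MVT_segment R g (fun x => (1 - (1 - x / M) ^+ n) / x - x^-1) t M tM.
- by move=> x /[!in_itv]/= /andP[tx _]; apply: dg; exact: lt_trans tx.
- apply: derivable_within_continuous => x /[!in_itv]/= /andP[tx _].
  by have := dg x (lt_le_trans t0 tx); case.
rewrite in_itv/= => /andP[tc cM].
have c0 : 0 < c by exact: lt_le_trans tc.
rewrite {1}/g ln_poly_end ?gt_eqF// subrr sub0r /g => /(congr1 Num.norm).
rewrite normrN => ->.
have u0 : 0 <= 1 - c / M by rewrite subr_ge0 ler_pdivrMr// mul1r.
have -> : (1 - (1 - c / M) ^+ n) / c - c^-1 = - ((1 - c / M) ^+ n / c).
  by field; rewrite gt_eqF.
rewrite normrM normrN !ger0_norm ?subr_ge0 ?divr_ge0 ?exprn_ge0 ?(ltW c0)//.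
have le1 : (1 - c / M) ^+ n <= (1 - m / M) ^+ n.
  rewrite lerXn2r ?nnegrE//; last first.
    by rewrite lerD2l lerN2 ler_pM2r ?invr_gt0// (le_trans mt).
  by rewrite subr_ge0 ler_pdivrMr// mul1r (le_trans mt).
rewrite mulrAC -mulrA mulrC; apply: ler_pM => //.
- by rewrite divr_ge0 ?(ltW c0)// subr_ge0.
- by rewrite exprn_ge0.
apply: ler_pM; rewrite ?subr_ge0 ?invr_ge0 ?(ltW c0)//; first by lra.
by rewrite lef_pV2 ?posrE// (le_trans mt).
Qed.

(* Newton's iteration [y |-> y (3 - t y^2) / 2] for [t `^ (-1/2)]. *)
Fixpoint invsqrt_poly M n : {poly R} :=
  if n is k.+1 then
    2^-1 *: (invsqrt_poly M k * (3%:R%:P - 'X * invsqrt_poly M k ^+ 2))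
  else (Num.sqrt M)^-1%:P.

(** In terms of [z] the iteration is [z |-> z (3 - z^2) / 2], which increases on [[r, 1]] towards
    its fixed point 1; each step multiplies [1 - z] by [(1 - z) (2 + z) / 2], at most [1 - r / 2].
    The initial polynomial puts [z] in [[r, 1]]. *)
Lemma invsqrt_poly_bounds m M n t : 0 < m -> m <= t <= M ->
  let z := Num.sqrt t * (invsqrt_poly M n).[t] in
  let r := Num.sqrt m / Num.sqrt M in
  r <= z /\ 0 <= 1 - z <= (1 - r / 2) ^+ n.
Proof.
move=> m0 /andP[mt tM]; have t0 : 0 < t by exact: lt_le_trans mt.
have M0 : 0 < M by exact: lt_le_trans tM.
have sM : 0 < Num.sqrt M by rewrite sqrtr_gt0.
have r0 : 0 < Num.sqrt m / Num.sqrt M by rewrite divr_gt0 ?sqrtr_gt0.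
set r := _ / _ in r0 *.
elim: n => [|n]/=.
  rewrite hornerC expr0; split; first by rewrite ler_pM2r ?invr_gt0// ler_wsqrtr.
  have z0 : 0 <= Num.sqrt t / Num.sqrt M by rewrite divr_ge0 ?sqrtr_ge0.
  by rewrite subr_ge0 ler_pdivrMr// mul1r ler_wsqrtr//= gerBl.
set y := (invsqrt_poly M n).[t]; set z := Num.sqrt t * y.
rewrite hornerZ hornerM hornerD hornerN hornerM horner_exp hornerC hornerX -/y.
move=> [rz /andP[z1 zn]].
have -> : Num.sqrt t * (2^-1 * (y * (3%:R - t * y ^+ 2))) = z * (3%:R - z ^+ 2) / 2.
  by rewrite /z exprMn sqr_sqrtr ?(ltW t0)//; ring.
have z0 : 0 < z by exact: lt_le_trans rz.
have e1 : 1 - z * (3%:R - z ^+ 2) / 2 = (1 - z) * ((1 - z) * (2 + z) / 2) by field.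
have f0 : 0 <= (1 - z) * (2 + z) / 2.
  by rewrite divr_ge0// mulr_ge0//; lra.
have fr : (1 - z) * (2 + z) / 2 <= 1 - r / 2 by nra.
split.
  apply: le_trans rz _.
  have -> : z * (3%:R - z ^+ 2) / 2 = z + z * ((1 - z) * (1 + z)) / 2 by field.
  by rewrite lerDl divr_ge0// mulr_ge0 ?(ltW z0)// mulr_ge0//; lra.
rewrite e1 mulr_ge0//= exprSr ler_pM//.
Qed.

Lemma invsqrt_poly_approx m M n t : 0 < m -> m <= t <= M ->
  `|(invsqrt_poly M n).[t] - t `^ (- 2^-1)| <=
  (Num.sqrt m)^-1 * (1 - Num.sqrt m / Num.sqrt M / 2) ^+ n.
Proof.
move=> m0 /[dup] /andP[mt _] mtM; have t0 : 0 < t by exact: lt_le_trans mt.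
have [_ /andP[h0 h1]] := invsqrt_poly_bounds n m0 mtM.
have st : 0 < Num.sqrt t by rewrite sqrtr_gt0.
rewrite powRN powR12_sqrt ?(ltW t0)//.
have -> : (invsqrt_poly M n).[t] - (Num.sqrt t)^-1 =
  - ((Num.sqrt t)^-1 * (1 - Num.sqrt t * (invsqrt_poly M n).[t])).
  by field; rewrite gt_eqF.
rewrite normrN ger0_norm ?mulr_ge0 ?invr_ge0 ?(ltW st)//.
apply: ler_pM; rewrite ?invr_ge0 ?(ltW st)//.
by rewrite lef_pV2 ?posrE ?sqrtr_gt0// ler_wsqrtr.
Qed.

Lemma ln_poly_cvg m M e : 0 < m -> m <= M -> 0 < e ->
  exists N, forall n, (N <= n)%N ->
  forall t, m <= t <= M -> `|(ln_poly M n).[t] - ln t| < e.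
Proof.
move=> m0 mM e0; have M0 : 0 < M by exact: lt_le_trans mM.
have k01 : 0 <= 1 - m / M < 1.
  by rewrite subr_ge0 ler_pdivrMr// mul1r mM gtrBl divr_gt0.
have [N NP] := geometric_lt (M / m) k01 e0; exists N => n Nn t mtM.
apply: le_lt_trans NP; apply: le_trans (ln_poly_approx n m0 mtM) _.
have /andP[k0 k1] := k01.
by rewrite ler_pM2l ?divr_gt0// ler_wiXn2l// ltW.
Qed.

Lemma invsqrt_poly_cvg m M e : 0 < m -> m <= M -> 0 < e ->
  exists N, forall n, (N <= n)%N ->
  forall t, m <= t <= M -> `|(invsqrt_poly M n).[t] - t `^ (- 2^-1)| < e.
Proof.
move=> m0 mM e0; have M0 : 0 < M by exact: lt_le_trans mM.
have sm : 0 < Num.sqrt m by rewrite sqrtr_gt0.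
have sM : 0 < Num.sqrt M by rewrite sqrtr_gt0.
have r0 : 0 < Num.sqrt m / Num.sqrt M by rewrite divr_gt0.
have r1 : Num.sqrt m / Num.sqrt M <= 1 by rewrite ler_pdivrMr// mul1r ler_wsqrtr.
have k01 : 0 <= 1 - Num.sqrt m / Num.sqrt M / 2 < 1 by apply/andP; split; lra.
have [N NP] := geometric_lt (Num.sqrt m)^-1 k01 e0; exists N => n Nn t mtM.
apply: le_lt_trans NP; apply: le_trans (invsqrt_poly_approx n m0 mtM) _.
have /andP[k0 k1] := k01.
by rewrite ler_pM2l ?invr_gt0// ler_wiXn2l// ltW.
Qed.

End PolynomialApproximation.

(** * Form bounds and the Thompson metric *)

Section Thompson.
Context {R : realType} {H : completeNormedModType R[i]}.
Context (dot : {dot H for Num.conj}) (hdot : hilbert_norm dot).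
Implicit Types (A B T : H -> H) (p q : {poly R}) (x y : H) (f : R -> R).

Lemma spectrum_le A (t M : R) : bounded_operator A ->
  (forall x, rdot dot (A x) x <= M * nrm x ^+ 2) ->
  real_spectrum A t -> t <= M.
Proof.
move=> bA hM specA; have lA := bA.1.
rewrite leNgt; apply/negP => tM; apply: specA.
have -> : A - (fun x => t%:C *: x) = (-1 : R[i]) *: poly_op (t%:P - 'X) A.
  by rewrite -poly_op_XsubC// -[in LHS](opprB t%:P) poly_opN scaleN1r.
have bT := bounded_poly_op (t%:P - 'X) bA.
apply: invertible_scale; [by rewrite oppr_eq0 oner_eq0|by case: bT|].
apply: (@coercive_invertible _ _ _ hdot _ (t - M)) => //; first by rewrite subr_gt0.
move=> x; rewrite poly_opB fctE poly_opC poly_opX// rdotBl rdotZl (rdotxx hdot).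
by rewrite mulrBl lerD2l lerN2.
Qed.

Lemma Bpp_selfadjoint A : Bpp dot A -> selfadjoint dot A.
Proof. by case=> -[lA _] pA _; exact: positive_selfadjoint. Qed.

Lemma Bpp_rdot_ge0 A x : Bpp dot A -> 0 <= rdot dot (A x) x.
Proof. by case=> _ pA _; have := pA x; rewrite lecE => /andP[]. Qed.

Lemma Bpp_scale (l : R) A : 0 < l -> Bpp dot A -> Bpp dot (l%:C *: A).
Proof.
move=> l0 [bA pA iA]; split.
- exact: bounded_scale.
- by move=> x; rewrite fctE linearZl_LR/= mulr_ge0// ler0c ltW.
- by apply: invertible_scale => //; [rewrite fmorph_eq0 gt_eqF|case: bA].
Qed.

(** * Spectral bounds, logarithm and inverse square root of positive invertible operators *)

Context (Hnz : exists x : H, x != 0).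

(** Let [t] be the spectral point bounding the form from below. If [t] times the norm [b] of the
    inverse were below 1, then [A - t = A (1 - t A^-1)] would be invertible, its second factor being
    coercive. *)
Lemma Bpp_lower_bound A : Bpp dot A -> 0 < opnorm (op_inv A) /\
  forall x, (opnorm (op_inv A))^-1 * nrm x ^+ 2 <= rdot dot (A x) x.
Proof.
move=> hA; have [bA pA iA] := hA; have sA := Bpp_selfadjoint hA; have lA := bA.1.
have [bI AI IA] := op_invP iA; set I := op_inv A in bI AI IA *; set b := opnorm I.
have b0 : 0 <= b by exact: opnorm_ge0.
have [t tA At] := spectrum_lower_bound hdot Hnz bA sA.
have t0 : 0 <= t.
  by apply: (spectrum_ge hdot bA _ tA) => x; rewrite mul0r; exact: Bpp_rdot_ge0.
have tb : 1 <= t * b.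
  rewrite leNgt; apply/negP => tb; apply: tA.
  have -> : A - (fun x => t%:C *: x) = A \o (id - t%:C *: I).
    apply/funext => x; rewrite /= !fctE lin_sub// (lin_scale lA).
    by have /= -> := congr1 (@^~ x) AI.
  apply: invertible_comp => //.
  apply: (@coercive_invertible _ _ _ hdot _ (1 - t * b)).
  - by apply: bounded_sub; [exact: bounded_id|exact: bounded_scale].
  - by rewrite subr_gt0.
  move=> x; rewrite !fctE rdotBl rdotZl (rdotxx hdot) mulrBl mul1r lerD2l lerN2.
  by rewrite -mulrA ler_wpM2l// rdot_opnorm_le.
have b1 : 0 < b.
  by rewrite lt0r b0 andbT; apply: contraTneq tb => ->; rewrite mulr0 ler10.
split=> // x; apply: le_trans (At x).
by rewrite ler_wpM2r ?sqr_ge0// -[b^-1]mul1r ler_pdivrMr.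
Qed.

Lemma Bpp_opnorm_gt0 A : Bpp dot A -> 0 < opnorm A.
Proof.
move=> hA; have [I0 hI] := Bpp_lower_bound hA; have [x x0] := Hnz.
have n0 : 0 < nrm x ^+ 2 by rewrite exprn_gt0// lt0r nrm_eq0 x0 nrm_ge0.
rewrite -(pmulr_lgt0 _ n0).
apply: lt_le_trans (rdot_opnorm_le hdot x _); last by case: hA.
by apply: lt_le_trans (hI x); rewrite mulr_gt0// invr_gt0.
Qed.

(** The spectrum lies in a compact interval of positive reals, where the polynomials for [ln] and
    the inverse square root converge uniformly. *)
Lemma Bpp_spectrum_bounds A : Bpp dot A ->
  exists m : R, [/\ 0 < m, m <= opnorm A &
    forall t, real_spectrum A t -> m <= t <= opnorm A].
Proof.
move=> hA; have [bA pA iA] := hA; have sA := Bpp_selfadjoint hA.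
have [I0 hI] := Bpp_lower_bound hA.
have spec t : real_spectrum A t -> (opnorm (op_inv A))^-1 <= t <= opnorm A.
  move=> tA; rewrite (spectrum_ge hdot bA hI tA)/=.
  have := le_spectrum_poly_op hdot 'X bA sA tA.
  by rewrite hornerX poly_opX//; case: bA.
exists (opnorm (op_inv A))^-1; split=> //; first by rewrite invr_gt0.
have [t /spec/andP[h1 h2] _] := spectrum_lower_bound hdot Hnz bA sA.
exact: le_trans h2.
Qed.

Lemma Bpp_op_log A : Bpp dot A -> is_cfc (@ln R) A (op_log A).
Proof.
move=> hA; have [bA _ _] := hA; have [m [m0 mM specA]] := Bpp_spectrum_bounds hA.
apply: (cfc_exists hdot Hnz (p := ln_poly (opnorm A)) bA (Bpp_selfadjoint hA)).
move=> e e0; have [N NP] := ln_poly_cvg m0 mM e0.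
by exists N => n Nn t /specA; exact: NP.
Qed.

Lemma Bpp_op_invsqrt A : Bpp dot A ->
  is_cfc (fun t : R => t `^ (- 2^-1)) A (op_invsqrt A).
Proof.
move=> hA; have [bA _ _] := hA; have [m [m0 mM specA]] := Bpp_spectrum_bounds hA.
apply: (cfc_exists hdot Hnz (p := invsqrt_poly (opnorm A)) bA (Bpp_selfadjoint hA)).
move=> e e0; have [N NP] := invsqrt_poly_cvg m0 mM e0.
by exists N => n Nn t /specA; exact: NP.
Qed.

(** If [p] is close to the inverse square root on the spectrum, [q = X p^2 - 1] is small there, so
    [A P^2 - 1] is small in norm, while [P] is close to [S]. *)
Lemma op_invsqrt_sqr A x : Bpp dot A -> A (op_invsqrt A (op_invsqrt A x)) = x.
Proof.
move=> hA; have [bA _ _] := hA; have [m [m0 mM specA]] := Bpp_spectrum_bounds hA.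
have lA := bA.1; have sA := Bpp_selfadjoint hA.
have cS := Bpp_op_invsqrt hA; set S := op_invsqrt A in cS *.
have bS := cS.1; set M := opnorm A in mM specA; set s := opnorm S.
have s0 : 0 <= s by exact: opnorm_ge0.
have M0 : 0 < M by exact: lt_le_trans mM.
apply/eqP; rewrite -subr_eq0; apply/eqP.
pose k := (Num.sqrt m)^-1; have k0 : 0 <= k by rewrite invr_ge0 sqrtr_ge0.
(* The first term pays for replacing [S^2] by [P^2], the second for [q(A)]; [k] bounds the inverse
   square root on the spectrum. *)
pose D := M * (s + (s + 1)) + M * (k *+ 2 + 1).
have D0 : 0 <= D by rewrite addr_ge0// mulr_ge0 ?(ltW M0)// !addr_ge0.
apply: (@nrm_small_eq0 _ _ _ (D * nrm x)) => e' e'0.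
(* Having [e <= 1] bounds the norm of [P] by [s + 1] and makes the quadratic error linear in [e]. *)
pose e := Num.min e' 1.
have e0 : 0 < e by rewrite lt_min e'0 ltr01.
have e1 : e <= 1 by rewrite ge_min lexx orbT.
apply: (@le_trans _ _ (e * (D * nrm x))); last first.
  by rewrite ler_wpM2r ?mulr_ge0 ?nrm_ge0// ge_min lexx.
have [p [pf pS _]] := is_cfc_approx bA cS e0.
set P := poly_op p A in pS; have bP : bounded_operator P by exact: bounded_poly_op.
pose q := 'X * (p * p) - 1%:P.
have hq : opnorm (poly_op q A) <= e * (M * (k *+ 2 + 1)).
  have [t /[dup] tA /specA /andP[mt tM] <-] :=
    spectrum_poly_op_attained hdot Hnz q bA sA.
  have t0 : 0 < t by exact: lt_le_trans mt.
  have st : 0 < Num.sqrt t by rewrite sqrtr_gt0.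
  have := pf t tA; rewrite powRN powR12_sqrt ?(ltW t0)//; set u := _^-1 => hu.
  have tu : t * u ^+ 2 = 1.
    by rewrite -[t in LHS](sqr_sqrtr (ltW t0)) -exprMn /u divff ?expr1n// gt_eqF.
  have u0 : 0 <= u by rewrite invr_ge0 ltW.
  have uk : u <= k by rewrite lef_pV2 ?posrE ?sqrtr_gt0// ler_wsqrtr.
  rewrite hornerD hornerN !hornerM hornerX hornerC -{1}tu.
  have -> : t * (p.[t] * p.[t]) - t * u ^+ 2 =
    (p.[t] - u) * (t * ((p.[t] - u) + u *+ 2)) by ring.
  rewrite normrM; apply: ler_pM => //; first exact: ltW.
  rewrite normrM ger0_norm ?(ltW t0)//; apply: ler_pM => //; first exact: ltW.
  rewrite (le_trans (ler_normD _ _))// [leRHS]addrC lerD//.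
    by rewrite (le_trans (ltW hu)).
  by rewrite ger0_norm ?mulrn_wge0// lerMn2r uk.
have APP : nrm (A (P (P x)) - x) <= e * (M * (k *+ 2 + 1)) * nrm x.
  have <- : poly_op q A x = A (P (P x)) - x.
    by rewrite poly_opB !poly_opM// !fctE poly_opC scale1r /= poly_opX.
  rewrite (le_trans (le_opnorm (bounded_poly_op q bA) x))//.
  by rewrite ler_wpM2r ?nrm_ge0.
have Px : nrm (P x) <= (s + 1) * nrm x.
  rewrite -[P x](subrK (S x)) (le_trans (nrmD _ _))// addrC mulrDl lerD//.
    exact: le_opnorm.
  by rewrite (le_trans (pS x))// ler_wpM2r ?nrm_ge0.
have ASP : nrm (A (S (S x)) - A (P (P x))) <= e * (M * (s + (s + 1))) * nrm x.
  rewrite -lin_sub//; apply: le_trans (le_opnorm bA _) _.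
  rewrite mulrCA -!mulrA ler_pM2l// (le_trans (nrm_triangle (S (P x)) _ _))//.
  rewrite mulrDl mulrDr; apply: lerD.
    rewrite -(lin_sub bS.1); apply: le_trans (le_opnorm bS _) _.
    by rewrite mulrCA ler_wpM2l// nrmB.
  rewrite nrmB; apply: le_trans (pS _) _.
  by rewrite ler_pM2l.
rewrite (le_trans (nrm_triangle (A (P (P x))) _ _))// (le_trans (lerD ASP APP))//.
by rewrite -mulrDl -mulrDr mulrA.
Qed.

Lemma op_invsqrt_selfadjoint A : Bpp dot A -> selfadjoint dot (op_invsqrt A).
Proof.
move=> hA; have [bA _ _] := hA.
exact: (is_cfc_selfadjoint hdot bA (Bpp_selfadjoint hA) (Bpp_op_invsqrt hA)).
Qed.

Lemma dot_ext x y : (forall z, dot x z = dot y z) -> x = y.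
Proof.
move=> xy; apply/eqP; rewrite -subr_eq0 -nrm_eq0 -sqrf_eq0 -(rdotxx hdot).
by rewrite rdotBl /rdot xy subrr.
Qed.

(** This is the adjoint of the preceding identity, all factors being self-adjoint. *)
Lemma op_invsqrt_sqr_comm A x : Bpp dot A -> op_invsqrt A (op_invsqrt A (A x)) = x.
Proof.
move=> hA; have sS := op_invsqrt_selfadjoint hA; apply: dot_ext => z.
by rewrite !sS (Bpp_selfadjoint hA) op_invsqrt_sqr.
Qed.

Lemma op_invsqrt_invertible A : Bpp dot A -> invertible (op_invsqrt A).
Proof.
move=> hA; have [bA _ _] := hA; have [bS _] := Bpp_op_invsqrt hA.
exists (op_invsqrt A \o A); split; first exact: bounded_comp.
  by apply/funext => x /=; rewrite op_invsqrt_sqr_comm.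
apply/funext => x /=.
(* Putting [A S S = id] in front of both sides of [S A S x = x] lets [S S A = id] finish. *)
rewrite -[RHS](op_invsqrt_sqr _ hA) -[LHS](op_invsqrt_sqr _ hA).
by rewrite op_invsqrt_sqr_comm.
Qed.

Lemma Bpp_congruence A B : Bpp dot A -> Bpp dot B ->
  Bpp dot (op_invsqrt A \o B \o op_invsqrt A).
Proof.
move=> hA [bB pB iB]; have [bS _] := Bpp_op_invsqrt hA.
have iS := op_invsqrt_invertible hA; split.
- exact: bounded_comp (bounded_comp bS bB) bS.
- by move=> x /=; rewrite (op_invsqrt_selfadjoint hA).
- exact: invertible_comp (invertible_comp iS iB) iS.
Qed.

(** * Comparison of quadratic forms, norms and condition numbers *)

Lemma op_log_bounds A : Bpp dot A ->
  forall x, expR (- opnorm (op_log A)) * nrm x ^+ 2 <= rdot dot (A x) x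
         <= expR (opnorm (op_log A)) * nrm x ^+ 2.
Proof.
move=> hA x; have [bA _ _] := hA; have sA := Bpp_selfadjoint hA.
have [m [m0 _ specA]] := Bpp_spectrum_bounds hA; set L := opnorm _.
have spec t : real_spectrum A t -> expR (- L) <= t <= expR L.
  move=> tA; have /andP[mt _] := specA t tA.
  have := spectrum_cfc_le hdot bA sA (Bpp_op_log hA) tA.
  have t0 : 0 < t by exact: lt_le_trans mt.
  by rewrite -{2 3}(lnK t0) !ler_expR ler_norml.
have [t1 /spec/andP[t1L _] At1] := spectrum_lower_bound hdot Hnz bA sA.
have [t2 /spec/andP[_ t2L] At2] := spectrum_upper_bound hdot Hnz bA sA.
by rewrite (le_trans _ (At1 x)) ?(le_trans (At2 x))// ler_wpM2r ?sqr_ge0.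
Qed.

Lemma thompson_form_bounds A B : Bpp dot A -> Bpp dot B -> forall x,
  expR (- thompson A B) * rdot dot (A x) x <= rdot dot (B x) x
    <= expR (thompson A B) * rdot dot (A x) x.
Proof.
move=> hA hB x; have hC := Bpp_congruence hA hB; rewrite /thompson.
(* With [S] the inverse square root, [S A x] stands for [A^(1/2) x]: its squared norm is the form of
   [A] at [x], and [S] maps it back to [x]. *)
have := op_log_bounds hC (op_invsqrt A (A x)); move: (opnorm _) => mu.
have sS := op_invsqrt_selfadjoint hA.
by rewrite -(rdotxx hdot) /= !(selfadjoint_rdot _ _ sS) op_invsqrt_sqr_comm//.
Qed.

(** The norm of [B] is itself a spectral point of [B], so a bound on the form of [B] bounds it. *)
Lemma opnorm_le_form A B (a : R) : Bpp dot A -> Bpp dot B -> 0 < a ->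
  (forall x, rdot dot (B x) x <= a * rdot dot (A x) x) ->
  opnorm B <= a * opnorm A.
Proof.
move=> hA hB a0 BA; have [bA _ _] := hA; have [bB _ _] := hB.
have sB := Bpp_selfadjoint hB; have lB := bB.1.
have [t tB] := spectrum_poly_op_attained hdot Hnz 'X bB sB.
rewrite hornerX poly_opX// => <-.
rewrite ger0_norm; last first.
  by apply: (spectrum_ge hdot bB _ tB) => x; rewrite mul0r; exact: Bpp_rdot_ge0.
apply: (spectrum_le bB _ tB) => x; apply: le_trans (BA x) _.
by rewrite -mulrA ler_pM2l// rdot_opnorm_le.
Qed.

(** The lower bound on the form of [A] carries over to [B], and a coercivity constant of [B] bounds
    its inverse. *)
Lemma opnorm_inv_le_form A B (b : R) : Bpp dot A -> Bpp dot B -> 0 < b ->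
  (forall x, rdot dot (A x) x <= b * rdot dot (B x) x) ->
  opnorm (op_inv B) <= b * opnorm (op_inv A).
Proof.
move=> hA hB b0 AB; have [I0 hI] := Bpp_lower_bound hA.
have c0 : 0 < b * opnorm (op_inv A) by rewrite mulr_gt0.
have Bc x : (b * opnorm (op_inv A))^-1 * nrm x ^+ 2 <= rdot dot (B x) x.
  rewrite -(ler_pM2l b0) invfM -mulrA mulVKf ?gt_eqF//.
  exact: le_trans (hI x) (AB x).
have [_ _ iB] := hB; have [_ BI _] := op_invP iB.
apply: opnorm_le; first exact: ltW.
move=> y; have := coercive_below hdot Bc (op_inv B y).
have /= -> := congr1 (@^~ y) BI.
by rewrite mulrC ler_pdivrMr// mulrC.
Qed.

Lemma OLC_le_form A B (a b : R) : Bpp dot A -> Bpp dot B -> 0 < a -> 0 < b ->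
  (forall x, rdot dot (B x) x <= a * rdot dot (A x) x) ->
  (forall x, rdot dot (A x) x <= b * rdot dot (B x) x) ->
  OLC B <= OLC A + 2^-1 * ln (a * b).
Proof.
move=> hA hB a0 b0 BA AB.
have h1 := opnorm_le_form hA hB a0 BA; have h2 := opnorm_inv_le_form hA hB b0 AB.
have nA := Bpp_opnorm_gt0 hA; have nB := Bpp_opnorm_gt0 hB.
have [iA _] := Bpp_lower_bound hA; have [iB _] := Bpp_lower_bound hB.
rewrite /OLC /condition_number -mulrDr ler_pM2l ?invr_gt0// addrC.
rewrite -lnM ?posrE ?mulr_gt0// ler_ln ?posrE ?mulr_gt0// mulrACA.
by apply: ler_pM => //; exact: ltW.
Qed.

Lemma OLC_dist_le A B (l : R) : Bpp dot A -> Bpp dot B -> 0 < l ->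
  `|OLC A - OLC B| <= thompson A (l%:C *: B).
Proof.
move=> hA hB l0; have hlB := Bpp_scale l0 hB.
have := thompson_form_bounds hA hlB; move: (thompson _ _) => mu hmu.
(* The two form constants are [expR mu / l] and [expR mu * l]; [l] cancels in their product, which
   is why only rays matter. *)
have a0 : 0 < expR mu / l by rewrite divr_gt0// expR_gt0.
have b0 : 0 < expR mu * l by rewrite mulr_gt0// expR_gt0.
have BA x : rdot dot (B x) x <= expR mu / l * rdot dot (A x) x.
  have /andP[_] := hmu x; rewrite fctE rdotZl => h.
  by rewrite mulrAC ler_pdivlMr// mulrC.
have AB x : rdot dot (A x) x <= expR mu * l * rdot dot (B x) x.
  have /andP[+ _] := hmu x; rewrite fctE rdotZl expRN => h.
  by rewrite -mulrA -ler_pdivrMl ?expR_gt0.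
have e2 : 2^-1 * ln (expR mu / l * (expR mu * l)) = mu.
  have -> : expR mu / l * (expR mu * l) = expR mu * expR mu.
    by field; rewrite gt_eqF.
  by rewrite lnM ?posrE ?expR_gt0// expRK; field.
have h1 := OLC_le_form hA hB a0 b0 BA AB.
have h2 := OLC_le_form hB hA b0 a0 AB BA.
rewrite mulrC in h2; rewrite [_ * (_ / l)]mulrC in h2.
by move: h1 h2; rewrite e2 ler_norml; lra.
Qed.

End Thompson.

Theorem corollary3p2 (R : realType) (H : completeNormedModType R[i])
    (dot : {dot H for Num.conj}) (hdot : hilbert_norm dot) (A B : H -> H)
    (hA : Bpp dot A) (hB : Bpp dot B) :
  `|OLC A - OLC B| <= proj_thompson A B.
Proof.
(* The bound holds for each [l]; the witness [l = 1] shows that the infimum is over a nonempty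
   set. *)
apply: lb_le_inf; first by exists (thompson A (1%:C *: B)), 1 => //=.
move=> _ [l /= l0 <-].
(* On the zero space spectra are empty and the spectral argument fails, but all maps coincide: the
   left side is 0 and the distance is the norm of the zero map. *)
have [Hnz|Hz] := pselect (exists x : H, x != 0); first exact: (OLC_dist_le hdot).
have H0 (x : H) : x = 0.
  by apply/eqP; apply: contrapT => /negP x0; apply: Hz; exists x.
have fE (f g : H -> H) : f = g by apply/funext => x; rewrite (H0 (f x)) (H0 (g x)).
rewrite (fE A B) subrr normr0 /thompson (fE (op_log _) 0).
by apply: opnorm_ge0; exact: bounded_zero.
Qed.
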